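(* For $k\in\mathbb{N}$ let $n_k=\lceil 2^{k+2}/3\rceil$ and $$\alpha_k=(k-1)n_k+2-\left\lfloor\frac{k+1}{2}\right\rfloor .$$ For all $k\in\mathbb{N}$ we have $$\mathcal{H}(n_k,t)=(-1)^{\frac{(k+1)(k+2)}{2}}\,t^{\alpha_k}(t-2)^{n_k-2}(1+t+\cdots+t^k).$$ In particular, the Hankel determinants for the usual binary sum of digits satisfy $$\mathcal{H}(n_k,1)=(-1)^{\frac{(k+2)(k+3)}{2}}(k+1).$$
   Context: $\mathbb{N}=\{0,1,2,\ldots\}$. For $n\in\mathbb{N}$ with binary expansion $n=\sum_{j=0}^l\varepsilon_j2^j$, $\varepsilon_j\in\{0,1\}$, put $S(n,t)=\sum_{j=0}^l\varepsilon_jt^j$, a polynomial in $t$. For $n\ge1$ let $\mathcal{H}(n,t)=\det[S(i+j,t)]_{0\le i,j<n}$. In particular $S(n,1)$ is the usual binary sum of digits of $n$. *)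

(* Defs.v *)
From mathcomp Require Import all_boot all_order all_algebra archimedean.
From mathcomp Require Import zify ring lra.

Set Implicit Arguments.
Unset Strict Implicit.
Unset Printing Implicit Defensive.

Import Order.TTheory GRing.Theory Num.Theory.
Local Open Scope ring_scope.

Definition binary_digit (n j : nat) : nat := ((n %/ 2 ^ j) %% 2)%N.

(* trunc_log 2 0 = 0, so digit_poly 0 = 0. *)
Definition digit_poly (n : nat) : {poly int} :=
  \sum_(j < (trunc_log 2 n).+1) (binary_digit n j)%:Z *: 'X^j.

Definition hankel (n : nat) : {poly int} :=
  \det (\matrix_(i < n, j < n) digit_poly (i + j)%N).

Definition nk (k : nat) : nat := `|Num.ceil ((2 ^+ (k + 2)%N / 3) : rat)|%N.

(* The subtractions are in int because k - 1 is negative at k = 0. *)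
Definition alpha (k : nat) : int :=
  (k%:Z - 1) * (nk k)%:Z + 2 - ((k + 1) %/ 2)%N%:Z.

Lemma binary_expansion (n : nat) :
  n = (\sum_(j < (trunc_log 2 n).+1) binary_digit n j * 2 ^ j)%N.
Proof.
have H m : (n = \sum_(j < m) binary_digit n j * 2 ^ j + n %/ 2 ^ m * 2 ^ m)%N.
  elim: m => [|m IH]; first by rewrite big_ord0 expn0 divn1 muln1.
  rewrite big_ord_recr /= {1}IH -addnA; congr (_ + _)%N.
  rewrite /binary_digit expnSr divnMA {1}(divn_eq (n %/ 2 ^ m) 2).
  by rewrite mulnDl addnC -mulnA [(2 * _)%N]mulnC.
rewrite {1}(H (trunc_log 2 n).+1) divn_small ?mul0n ?addn0 //.
exact: trunc_log_ltn.
Qed.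

Lemma digit_poly_at1 (n : nat) :
  (digit_poly n).[1] = (\sum_(j < (trunc_log 2 n).+1) binary_digit n j)%N%:Z.
Proof.
rewrite /digit_poly horner_sum -[RHS]natz natr_sum; apply: eq_bigr => j _.
by rewrite hornerZ hornerXn expr1n mulr1 natz.
Qed.

Lemma hankel_at1 (n : nat) :
  (hankel n).[1] = \det (\matrix_(i < n, j < n) (digit_poly (i + j)%N).[1]).
Proof.
rewrite -[LHS]/(horner_eval 1 _) /hankel -det_map_mx; congr (\det _).
by apply/matrixP => i j; rewrite !mxE.
Qed.

Lemma nkE (k : nat) : nk k = ((2 ^ (k + 2) + 2) %/ 3)%N.
Proof.
rewrite /nk; set m := (_ %/ _)%N.
suff -> : Num.ceil ((2 ^+ (k + 2)%N / 3) : rat) = m%:Z by [].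
apply/ceil_def.
have -> : (2 ^+ (k + 2) : rat) = (2 ^ (k + 2))%N%:R by rewrite natrX.
rewrite {}/m; move: (2 ^ _)%N => x; set m := (_ %/ _)%N.
have : (x <= 3 * m)%N by rewrite /m; lia.
have : (3 * m <= x + 2)%N by rewrite /m; lia.
move: m => m.
rewrite -(ler_nat rat) natrM natrD => h1.
rewrite -(ler_nat rat) natrM => h2.
rewrite rmorphB /= -!pmulrn; lra.
Qed.

Lemma nk_ge2 (k : nat) : (2 <= nk k)%N.
Proof.
rewrite nkE expnD; have := expn_gt0 2 k; move: (2 ^ k)%N => x /=; lia.
Qed.

Lemma alpha_ge0 (k : nat) : 0 <= alpha k.
Proof.
rewrite /alpha; case: k => [|k]; first by rewrite nkE.
have := nk_ge2 k.+1; move: (nk _) => m hm.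
have : ((k.+1 + 1) %/ 2 <= k + 1)%N by lia.
move: (_ %/ _)%N => q hq; nia.
Qed.

(* Main.v *)
Require Import Defs.
From mathcomp Require Import all_boot all_order all_fingroup all_algebra.
From mathcomp Require Import zify ring.
Import GRing.Theory.
Local Open Scope ring_scope.

(** The digit polynomials satisfy S(2s) = X S(s) and S(2s+1) = X S(s) + 1, so
sorting the rows and columns of a Hankel matrix by the parity of their index
turns it into a block matrix whose blocks are again Hankel matrices of S, up to
scaling by X and adding multiples of the all-ones matrix J. Subtracting the
even rows and columns from the odd ones leaves, at size p + q with p even and
q odd indices (so q <= p <= q + 1),
  [ X S_p      J       ]
  [   J     X D_q - 2J ]
where S_n is the Hankel matrix of S and D_n that of D(s) = S(s+1) - S(s).
Because J has rank one, the determinant of such a matrix is governed by two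
numbers per diagonal block: det A and the coefficient g(A) of x in the affine
polynomial det (A + x J). This is [det_block_ones]:
  det [ A J ; J M ] = det A det M - g(A) g(M).

Put F_q = det (X D_q - 2J). The splitting gives
  g(S_(p+q)) = X^(p-1) g(S_p) F_q,
and for odd q one has F_q = (X - 2) g(X D_q), so that
(X - 2) det S_p = - c g(S_p) implies the same relation at p + q with X c + 1
in place of c. Along n_0, n_1, ... the factor c is therefore
1 + X + ... + X^k, and only the product formula for g(S_(n_k)) remains.

The identity F_q = (X - 2) g(X D_q) holds since det D_q = g(D_q) for odd q:
D(2s) = 1, so when q = 2h + 1 the (h+1) x (h+1) block of the even indices in
D_q + x J is (1 + x) J, and in the determinant this block contributes one
factor 1 + x and nothing else ([det_ones_corner]). What is left is, up to sign
and a power of X, the square of the determinant T_h of the Hankel matrix of the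
second differences of S. A similar shear gives T_(p+q) = F_p X^q T_q. The sizes
that occur along n_k are the Jacobsthal numbers
j_k = 2 h_k + 1 = 1, 3, 5, 11, 21, ..., for which n_(k+1) = n_k + j_k, and
these relations close up into a recurrence that expresses F at j_(k+1) by F at
j_k and j_(k-1); its solution is, up to sign, a monomial in X and X - 2. *)

(** * Rank-one perturbations of determinants *)

(** This is v *m \adj A *m u; the bordered form makes it accessible to
block factorisations without inverting A. *)
Definition bordered_det (R : comPzRingType) (n : nat)
    (A : 'M[R]_n) (u : 'cV[R]_n) (v : 'rV[R]_n) : R :=
  \det (block_mx (0 : 'M_1) (- v) u A).
Arguments bordered_det {R n}.

Lemma det_add_rank1 (R : comPzRingType) (n : nat)
    (A : 'M[R]_n) (u : 'cV[R]_n) (v : 'rV[R]_n) :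
  \det (A + u *m v) = \det A + bordered_det A u v.
Proof.
(* Eliminating u with a unit corner gives the left side; the bordered matrix
   with unit corner is then split along its first row. *)
pose B (x : 'M[R]_1) (w : 'rV[R]_n) := block_mx x w u A.
have -> : \det (A + u *m v) = \det (B 1%:M (- v)).
  transitivity (\det (block_mx 1%:M 0 (- u) 1%:M *m B 1%:M (- v))).
    rewrite /B mulmx_block !mul0mx !mul1mx !addr0 mulmx1 addNr mulNmx mulmxN.
    by rewrite opprK [_ + A]addrC det_ublock det1 mul1r.
  by rewrite det_mulmx det_lblock !det1 !mul1r.
have eq_flat (X Y : 'M[R]_(0, 1 + n)) : X = Y.
  exact: etrans (flatmx0 _) (esym (flatmx0 _)).
rewrite (@determinant_multilinear _ _ (B 1%:M (- v)) (B 1%:M 0)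
  (B 0 (- v)) (lshift n ord0) 1 1); first last.
- rewrite /B /block_mx !(@row'Ku _ 0).
  exact: (congr1 (fun X : 'M_(0, _) => col_mx X (row_mx u A)) (eq_flat _ _)).
- rewrite /B /block_mx !(@row'Ku _ 0).
  exact: (congr1 (fun X : 'M_(0, _) => col_mx X (row_mx u A)) (eq_flat _ _)).
- rewrite !scale1r /B /block_mx !rowKu !row_row_mx add_row_mx.
  by rewrite row0 addr0 row0 add0r.
by rewrite !mul1r {1}/B det_lblock det1 mul1r.
Qed.

Lemma bordered_detZ (R : comPzRingType) (n : nat) (x : R)
    (A : 'M[R]_n) (u : 'cV[R]_n) (v : 'rV[R]_n) :
  bordered_det A (x *: u) v = x * bordered_det A u v.
Proof.
rewrite /bordered_det.
have -> : block_mx (0 : 'M_1) (- v) (x *: u) A =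
    block_mx 0 (- v) u A *m block_mx x%:M 0 0 1%:M.
  rewrite mulmx_block !mulmx0 !mul0mx !mulmx1 mul_mx_scalar.
  by rewrite !(addr0, add0r).
by rewrite det_mulmx det_lblock det1 det_scalar1 mulr1 mulrC.
Qed.

(** The factor x on the left avoids the exponent n - 1, and with it a special
case for n = 0. *)
Lemma scale_bordered_det (R : comPzRingType) (n : nat) (x : R)
    (A : 'M[R]_n) (u : 'cV[R]_n) (v : 'rV[R]_n) :
  x * bordered_det (x *: A) u v = x ^+ n * bordered_det A u v.
Proof.
rewrite -bordered_detZ /bordered_det.
have -> : block_mx (0 : 'M_1) (- v) (x *: u) (x *: A) =
    block_mx 1%:M 0 0 x%:M *m block_mx 0 (- v) u A.
  by rewrite mulmx_block !mulmx0 !mul0mx !mul1mx !mul_scalar_mx !addr0 !add0r.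
by rewrite det_mulmx det_lblock det1 det_scalar mul1r.
Qed.

(** The coefficient of x in det (A + x J), J the all-ones matrix; see
[det_add_const]. *)
Definition ones_coef (R : comPzRingType) (n : nat) (A : 'M[R]_n) : R :=
  bordered_det A (const_mx 1) (const_mx 1).
Arguments ones_coef {R n}.

Lemma mul_const_mx1 (R : comPzRingType) (m n : nat) (x y : R) :
  (const_mx x : 'cV[R]_m) *m (const_mx y : 'rV_n) = const_mx (x * y).
Proof. by apply/matrixP => i j; rewrite !mxE big_ord1 !mxE. Qed.

Lemma det_add_const (R : comPzRingType) (n : nat) (A : 'M[R]_n) (x : R) :
  \det (A + const_mx x) = \det A + x * ones_coef A.
Proof.
rewrite -{1}[x]mulr1 -mul_const_mx1 det_add_rank1 -bordered_detZ.
congr (_ + bordered_det _ _ _).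
by apply/matrixP => i j; rewrite !mxE mulr1.
Qed.

Lemma ones_coef_add_const (R : comPzRingType) (n : nat) (A : 'M[R]_n) (x : R) :
  ones_coef (A + const_mx x) = ones_coef A.
Proof.
have : \det (A + const_mx x + const_mx 1) = \det (A + const_mx (x + 1)).
  by congr (\det _); apply/matrixP => i j; rewrite !mxE addrA.
rewrite !det_add_const mulrDl addrA !mul1r.
exact: addrI.
Qed.

Lemma scale_ones_coef (R : comPzRingType) (n : nat) (x : R) (A : 'M[R]_n) :
  x * ones_coef (x *: A) = x ^+ n * ones_coef A.
Proof. exact: scale_bordered_det. Qed.

(** The upper right block is a rank-one perturbation of a block triangular
matrix. The bordered determinant that it contributes factors into one bordered
matrix that involves only A and one that involves only M, the remaining
diagonal blocks being identities. *)
Lemma det_block_ones (R : comPzRingType) (p q : nat)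
    (A : 'M[R]_p) (M : 'M[R]_q) :
  \det (block_mx A (const_mx 1) (const_mx 1) M) =
    \det A * \det M - ones_coef A * ones_coef M.
Proof.
pose u : 'cV[R]_(p + q) := col_mx (const_mx 1) 0.
pose v : 'rV[R]_(p + q) := row_mx 0 (const_mx 1).
have -> : block_mx A (const_mx 1) (const_mx 1) M =
    block_mx A 0 (const_mx 1) M + u *m v.
  rewrite mul_col_row !mul0mx mulmx0 mul_const_mx1 mulr1 add_block_mx.
  by rewrite !addr0 add0r.
rewrite det_add_rank1 det_lblock; congr (_ + _).
pose v' : 'rV[R]_(p + q) := row_mx (const_mx 1) 0.
pose u' : 'cV[R]_(p + q) := col_mx 0 (const_mx (-1)).
have -> : bordered_det (block_mx A 0 (const_mx 1) M) u v =
    bordered_det (block_mx 1%:M 0 0 M) u' v *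
    bordered_det (block_mx A 0 0 1%:M) u v'.
  rewrite /bordered_det -det_mulmx; congr (\det _).
  rewrite mulmx_block !mul0mx !mulmx0 !add0r mulmx_block !mulNmx !mulmxN.
  rewrite mul_row_col mul_row_block mul_col_row mul_block_col.
  rewrite opp_block_mx add_block_mx !(mul0mx, mulmx0, mul1mx, mulmx1).
  rewrite mul_const_mx1 !(addr0, add0r, oppr0, mulr1).
  congr (block_mx _ _ _ (block_mx _ _ _ _)).
  by apply/matrixP => i j; rewrite !mxE opprK.
have -> : bordered_det (block_mx A 0 0 1%:M) u v' = ones_coef A.
  have := det_add_rank1 R _ (block_mx A 0 0 1%:M) u v'.
  rewrite mul_col_row !mul0mx mulmx0 mul_const_mx1 mulr1 add_block_mx.
  rewrite !(addr0, add0r) !det_lblock !det1 !mulr1 det_add_const mul1r.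
  by move/addrI.
have -> : bordered_det (block_mx 1%:M 0 0 M) u' v = - ones_coef M.
  have := det_add_rank1 R _ (block_mx 1%:M 0 0 M) u' v.
  rewrite mul_col_row !mul0mx mulmx0 mul_const_mx1 mulr1 add_block_mx.
  rewrite !(addr0, add0r) !det_lblock !det1 !mul1r det_add_const mulN1r.
  by move/addrI.
by rewrite mulNr mulrC.
Qed.

Lemma det_block_antidiag (R : comPzRingType) (q : nat) (Z : 'M[R]_q) :
  \det (block_mx 0 1%:M 1%:M Z) = (-1) ^+ q.
Proof.
have: \det (block_mx 1%:M 0 (- 1%:M) 1%:M *m block_mx 1%:M 1%:M 0 1%:M
  *m block_mx 0 1%:M 1%:M Z) = (-1) ^+ q.
  rewrite !mulmx_block !(mul0mx, mulmx0, mul1mx, mulmx1, mulNmx, addr0, add0r).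
  by rewrite addNr mul0mx addr0 det_ublock det1 mul1r -scaleN1r detZ det1 mulr1.
by rewrite !det_mulmx det_lblock det_ublock !det1 !mul1r.
Qed.

(** With U = (1 | N), the matrix is the congruence transform by diag(U, 1) of a
matrix in which c sits alone in its row and column; whence the square, and the
linear dependence on c. *)
Lemma det_ones_corner (R : comPzRingType) (q : nat) (c : R)
    (N : 'M[R]_(1 + q, q)) (Z : 'M[R]_q) :
  \det (block_mx (const_mx c) N N^T Z) =
    (-1) ^+ q * c * \det (row_mx (const_mx 1) N) ^+ 2.
Proof.
pose U : 'M[R]_(1 + q) := row_mx (const_mx 1) N.
pose K : 'M[R]_(1 + q + q) :=
  block_mx (block_mx c%:M 0 0 0) (col_mx 0 1%:M) (row_mx 0 1%:M) Z.
have -> : block_mx (const_mx c) N N^T Z =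
    block_mx U 0 0 1%:M *m K *m block_mx U^T 0 0 1%:M.
  rewrite !mulmx_block !(mul0mx, mulmx0, mul1mx, mulmx1, addr0, add0r).
  rewrite mul_row_block mul_row_col.
  rewrite !(mul0mx, mulmx0, mul1mx, mulmx1, addr0, add0r).
  rewrite tr_row_mx mul_row_col mul_row_col.
  rewrite !(mul0mx, mulmx0, mul1mx, mulmx1, addr0, add0r).
  congr (block_mx _ _ _ _).
  by apply/matrixP => i j; rewrite mul_mx_scalar !mxE big_ord1 !mxE !mulr1.
have detK : \det K = c * (-1) ^+ q.
  rewrite -(det_block_antidiag _ _ Z) -[in RHS](det_scalar1 c).
  rewrite -(det_lblock _ 0); congr (\det _).
  rewrite /K -[0 : 'M_(q + q, 1)]vsubmxK -[0 : 'M_(1, q + q)]hsubmxK !linear0.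
  have := @block_mxA R 1 q q 1 q q c%:M 0 0 0 0 1%:M 0 1%:M Z.
  by rewrite /= castmx_id.
rewrite !det_mulmx !det_lblock det_tr !det1 detK /U; ring.
Qed.

(** * Hankel matrices *)

Definition hankel_mx (R : Type) (a : nat -> R) (m n : nat) : 'M[R]_(m, n) :=
  \matrix_(i < m, j < n) a (i + j)%N.
Arguments hankel_mx {R}.

(** Replacing each row by its difference from the previous one clears the
column of ones below its first entry. *)
Lemma det_ones_hankel (R : comPzRingType) (a : nat -> R) (q : nat) :
  \det (row_mx (const_mx 1) (hankel_mx a (1 + q) q)) =
    \det (hankel_mx (fun s => a s.+1 - a s) q q).
Proof.
(* S shifts rows down by one, so 1 - S takes the differences. *)
pose S : 'M[R]_(1 + q) := \matrix_(i, j) (i == j.+1 :> nat)%:R.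
have detS : \det (1%:M - S) = 1.
  rewrite det_trig.
    by apply: big1 => i _; rewrite !mxE eqxx ltn_eqF ?subr0.
  apply/is_trig_mxP => i j ij; rewrite !mxE -val_eqE.
  by rewrite (ltn_eqF ij) ltn_eqF ?subr0 //; apply: ltnW.
rewrite -[LHS]mul1r -detS -det_mulmx mulmxBl mul1mx.
have S_row0 (W : 'M_(1 + q)) j : (S *m W) (lshift q ord0) j = 0.
  by rewrite !mxE big1 // => k _; rewrite mxE mul0r.
have S_rowS (W : 'M_(1 + q)) i j :
    (S *m W) (rshift 1 i) j = W (widen_ord (leqnSn q) i) j.
  rewrite !mxE (bigD1 (widen_ord (leqnSn q) i)) //= mxE eqxx mul1r.
  rewrite big1 ?addr0 // => k; rewrite mxE -val_eqE /= => ki.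
  by rewrite eqSS eq_sym (negPf ki) mul0r.
have widenE (i : 'I_q) : widen_ord (leqnSn q) i = i :> nat by [].
transitivity (\det (block_mx (1%:M : 'M_1) (hankel_mx a 1 q) 0
    (hankel_mx (fun s => a s.+1 - a s) q q))).
  congr (\det _); apply/matrixP => i j; rewrite [LHS]mxE [X in _ + X]mxE.
  case: (split_ordP i) => {}i ->; [rewrite ord1 S_row0 subr0|rewrite S_rowS].
    rewrite [RHS]mxE (unsplitK (inl _)) ![row_mx _ _ _ _]mxE.
    by case: splitP => j' _; rewrite !mxE ?ord1.
  rewrite [RHS]mxE (unsplitK (inr _)) ![row_mx _ _ _ _]mxE.
  by case: splitP => j' _; rewrite !mxE ?subrr.
by rewrite det_ublock det1 mul1r.
Qed.

Lemma det_reindex (R : comPzRingType) (n : nat) (A : 'M[R]_n)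
    (s : {perm 'I_n}) :
  \det (\matrix_(i, j) A (s i) (s j)) = \det A.
Proof.
have -> : \matrix_(i, j) A (s i) (s j) = row_perm s (col_perm s A).
  by apply/matrixP => i j; rewrite !mxE.
rewrite row_permE col_permE !det_mulmx !det_perm odd_permV mulrCA.
by rewrite -expr2 sqrr_sign mulr1.
Qed.

(** Rows and columns are permuted alike, so no sign appears. *)
Lemma det_hankel_parity (R : comPzRingType) (a : nat -> R) (p q : nat) :
  (q <= p <= q.+1)%N ->
  \det (hankel_mx a (p + q) (p + q)) =
    \det (block_mx (hankel_mx (fun s => a s.*2) p p)
                   (hankel_mx (fun s => a s.*2.+1) p q)
                   (hankel_mx (fun s => a s.*2.+1) q p)
                   (hankel_mx (fun s => a s.*2.+2) q q)).
Proof.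
move=> /andP[qp pq].
pose f (i : 'I_(p + q)) : nat :=
  match split i with inl i => i.*2 | inr j => j.*2.+1 end.
have f_lt i : (f i < p + q)%N.
  by rewrite /f; case: splitP => j _; have := ltn_ord j; lia.
pose g i := Ordinal (f_lt i).
have g_inj : injective g.
  move=> i j /(congr1 val) /=; rewrite /f => fij; apply: val_inj => /=.
  by case: splitP fij => i' ->; case: splitP => j' ->; lia.
rewrite -(det_reindex _ _ _ (perm g_inj)); congr (\det _).
apply/matrixP => i j; rewrite !mxE !permE /= /f.
case: splitP => i' _; rewrite mxE; case: splitP => j' _; rewrite mxE;
  congr (a _); lia.
Qed.

(** Adds e times the even rows and columns to the odd ones; e = -1 suits the
digit polynomials and e = 1 their second differences, whose even and odd terms
are opposite. *)
Lemma det_hankel_shear (R : comPzRingType) (a : nat -> R) (e : R) (p q : nat) :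
  (q <= p <= q.+1)%N ->
  \det (hankel_mx a (p + q) (p + q)) =
    \det (block_mx
      (hankel_mx (fun s => a s.*2) p p)
      (hankel_mx (fun s => a s.*2.+1 + e * a s.*2) p q)
      (hankel_mx (fun s => a s.*2.+1 + e * a s.*2) q p)
      (hankel_mx (fun s => a s.*2.+2 + e * a s.*2.+1 *+ 2 + e ^+ 2 * a s.*2)
         q q)).
Proof.
move=> pq; rewrite (det_hankel_parity _ _ _ _ pq).
case/andP: pq => qp _.
pose P : 'M[R]_(q, p) := e *: pid_mx q.
have P_mul (b : nat -> R) r :
    P *m hankel_mx b p r = hankel_mx (fun s => e * b s) q r.
  apply/matrixP => i j; rewrite mxE (bigD1 (widen_ord qp i)) //= !mxE.
  rewrite eqxx ltn_ord mulr1 big1 ?addr0 // => k ki.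
  rewrite !mxE [(_ == _)%N]eq_sym [_ == _ :> nat](negPf ki) mulr0 mul0r //.
have trH (b : nat -> R) m n : (hankel_mx b m n)^T = hankel_mx b n m.
  by apply/matrixP => i j; rewrite !mxE addnC.
have mul_P (b : nat -> R) r :
    hankel_mx b r p *m P^T = hankel_mx (fun s => e * b s) r q.
  by rewrite -[hankel_mx b r p]trH -trmx_mul P_mul trH.
have shear (W : 'M[R]_(p + q)) : \det W =
    \det (block_mx 1%:M 0 P 1%:M *m W *m block_mx 1%:M P^T 0 1%:M).
  by rewrite !det_mulmx det_lblock det_ublock !det1 !mul1r !mulr1.
rewrite shear !mulmx_block.
rewrite !(mul0mx, mul1mx, mulmx0, mulmx1, addr0, add0r) mulmxDl !P_mul !mul_P.
by congr (\det (block_mx _ _ _ _)); apply/matrixP => i j; rewrite !mxE; ring.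
Qed.

(** * Digit polynomials and their differences *)

Lemma digit_poly_widen (n N : nat) : (n < 2 ^ N)%N ->
  digit_poly n = \sum_(j < N) (binary_digit n j)%:Z *: 'X^j.
Proof.
have stable M d : (n < 2 ^ M)%N ->
    \sum_(j < M + d) (binary_digit n j)%:Z *: 'X^j =
    \sum_(j < M) (binary_digit n j)%:Z *: 'X^j :> {poly int}.
  move=> nM; rewrite big_split_ord /= [X in _ + X]big1 ?addr0 // => j _.
  rewrite /binary_digit divn_small ?mod0n ?scale0r //.
  by apply: leq_trans nM _; rewrite leq_pexp2l ?leq_addr.
move=> nN; rewrite /digit_poly -(stable _ N) ?trunc_log_ltn //.
by rewrite addnC stable.
Qed.

Lemma digit_poly_bit (b : bool) (n : nat) :
  digit_poly (b + n.*2)%N = 'X * digit_poly n + b%:R.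
Proof.
have n_lt := ltn_expl n (ltnSn 1).
rewrite (digit_poly_widen _ n.+1); last by rewrite expnS; case: b; lia.
rewrite (digit_poly_widen n n) // big_ord_recl addrC; congr (_ + _).
  rewrite big_distrr /=; apply: eq_bigr => j _.
  rewrite -scalerAr -exprS /binary_digit /bump add1n expnS divnMA.
  by rewrite -muln2 addnC divnMDl // [(b %/ 2)%N]divn_small ?addn0 //; case: b.
rewrite /binary_digit expn0 divn1 -muln2 addnC modnMDl expr0 alg_polyC.
by case: b.
Qed.

Definition digit_diff (s : nat) : {poly int} := digit_poly s.+1 - digit_poly s.
Definition digit_diff2 (s : nat) : {poly int} := digit_diff s.+1 - digit_diff s.

Lemma digit_poly_even (s : nat) : digit_poly s.*2 = 'X * digit_poly s.
Proof. by rewrite (digit_poly_bit false) addr0. Qed.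

Lemma digit_poly_odd (s : nat) : digit_poly s.*2.+1 = 'X * digit_poly s + 1.
Proof. exact: (digit_poly_bit true). Qed.

Lemma digit_diff_even (s : nat) : digit_diff s.*2 = 1.
Proof. by rewrite /digit_diff digit_poly_odd digit_poly_even addrC addKr. Qed.

Lemma digit_diff_odd (s : nat) : digit_diff s.*2.+1 = 'X * digit_diff s - 1.
Proof.
by rewrite /digit_diff -doubleS digit_poly_odd digit_poly_even; ring.
Qed.

Definition diff_hankel (n : nat) : 'M[{poly int}]_n := hankel_mx digit_diff n n.

Definition diff_det (n : nat) : {poly int} :=
  \det ('X *: diff_hankel n + const_mx (- 2)).

Definition diff2_det (n : nat) : {poly int} := \det (hankel_mx digit_diff2 n n).

Definition digit_hankel (n : nat) : 'M[{poly int}]_n :=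
  hankel_mx digit_poly n n.

(** * Determinants split by parity *)

(** The shear makes the block matrix diagonal, since even and odd second
differences of S cancel. *)
Lemma diff2_det_split (p q : nat) : (q <= p <= q.+1)%N ->
  diff2_det (p + q) = diff_det p * ('X^q * diff2_det q).
Proof.
move=> pq; rewrite /diff2_det (det_hankel_shear _ _ 1 _ _ pq).
rewrite -detZ /diff_det -(det_ublock _ 0); congr (\det _).
congr (block_mx _ _ _ _); apply/matrixP => i j; rewrite !mxE;
  rewrite /digit_diff2 -?doubleS !(digit_diff_even, digit_diff_odd); ring.
Qed.

Lemma det_digit_hankel_split (p q : nat) (x : {poly int}) :
  (q <= p <= q.+1)%N ->
  \det (digit_hankel (p + q) + const_mx x) =
    \det ('X *: digit_hankel p + const_mx x) * diff_det q -
    ones_coef ('X *: digit_hankel p) * ones_coef ('X *: diff_hankel q).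
Proof.
move=> pq; rewrite -(ones_coef_add_const _ _ _ x).
rewrite -(ones_coef_add_const _ _ (_ *: diff_hankel q) (-2)) -det_block_ones.
have -> : digit_hankel (p + q) + const_mx x =
    hankel_mx (fun s => digit_poly s + x) (p + q) (p + q).
  by apply/matrixP => i j; rewrite !mxE.
rewrite (det_hankel_shear _ _ (-1) _ _ pq); congr (\det _).
congr (block_mx _ _ _ _); apply/matrixP => i j; rewrite !mxE;
  rewrite /digit_diff -?doubleS !(digit_poly_even, digit_poly_odd); ring.
Qed.

(** Differences of S at even arguments equal 1, so the block of the even indices
is constant and [det_ones_corner] applies. *)
Lemma det_diff_hankel_odd (q : nat) (x : {poly int}) :
  \det (diff_hankel (1 + q + q) + const_mx x) =
    (-1) ^+ q * (1 + x) * ('X^q * diff2_det q) ^+ 2.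
Proof.
have -> : diff_hankel (1 + q + q) + const_mx x =
    hankel_mx (fun s => digit_diff s + x) (1 + q + q) (1 + q + q).
  by apply/matrixP => i j; rewrite !mxE.
rewrite det_hankel_parity ?leqnn ?leqnSn //.
set N := hankel_mx _ _ q.
have NT : hankel_mx (fun s => digit_diff s.*2.+1 + x) q (1 + q) = N^T.
  by apply/matrixP => i j; rewrite !mxE addnC.
have J : hankel_mx (fun s => digit_diff s.*2 + x) (1 + q) (1 + q) =
    const_mx (1 + x).
  by apply/matrixP => i j; rewrite !mxE digit_diff_even.
rewrite NT J det_ones_corner det_ones_hankel; congr (_ * _ ^+ 2).
rewrite /diff2_det -detZ; congr (\det _); apply/matrixP => i j.
by rewrite !mxE /digit_diff2 !digit_diff_odd; ring.
Qed.

(** Perturbing by x only multiplies the determinant by 1 + x. *)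
Lemma det_ones_coef_diff_odd (q : nat) :
  \det (diff_hankel (1 + q + q)) = ones_coef (diff_hankel (1 + q + q)).
Proof.
have e0 := det_diff_hankel_odd q 0; have := det_diff_hankel_odd q 1.
rewrite det_add_const mul1r; rewrite det_add_const mul0r addr0 in e0.
rewrite e0 => e1; apply: (addrI (\det (diff_hankel (1 + q + q)))).
by rewrite e0 e1; ring.
Qed.

Lemma X_neq0 : 'X != 0 :> {poly int}.
Proof. by rewrite polyX_eq0. Qed.

(** At odd size n the determinant of D is its own ones_coef, so that
det (X D) = X^n det D = X^n ones_coef D = X ones_coef (X D); the perturbation
by -2 turns the factor X into X - 2. *)
Lemma diff_det_ones_coef_odd (q : nat) :
  diff_det (1 + q + q) =
    ('X - 2%:P) * ones_coef ('X *: diff_hankel (1 + q + q)).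
Proof.
apply: (mulfI X_neq0); rewrite /diff_det det_add_const detZ.
rewrite det_ones_coef_diff_odd -scale_ones_coef polyCMn.
ring.
Qed.

Lemma diff_det_odd (q : nat) :
  diff_det (1 + q + q) =
    (-1) ^+ q * 'X^(4 * q) * ('X - 2%:P) * diff2_det q ^+ 2.
Proof.
apply: (mulfI X_neq0); rewrite diff_det_ones_coef_odd mulrCA scale_ones_coef.
rewrite -det_ones_coef_diff_odd; have := det_diff_hankel_odd q 0.
rewrite det_add_const mul0r addr0 => ->.
rewrite exprMn -exprM.
have -> : (4 * q = q + q + q * 2)%N by lia.
by rewrite !exprD; ring.
Qed.

(** * Jacobsthal indices *)

Fixpoint jacobsthal_half (k : nat) : nat :=
  if k is k'.+1 then ((jacobsthal_half k').*2 + ~~ odd k')%N else 0%N.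

Lemma odd_jacobsthal_half (k : nat) : odd (jacobsthal_half k) = odd k.
Proof. by case: k => //= k; rewrite oddD odd_double oddb. Qed.

(** The shape 1 + h + h is the size 2h + 1 split into h + 1 even and h odd
indices. *)
Definition jacobsthal (k : nat) : nat :=
  (1 + jacobsthal_half k + jacobsthal_half k)%N.

Lemma nk_jacobsthal (k : nat) : nk k = (jacobsthal k + ~~ odd k)%N.
Proof.
have e : (3 * jacobsthal k + ~~ odd k = 2 ^ (k + 2) + odd k)%N.
  elim: k => [|k]; first by [].
  by rewrite addSn expnS /jacobsthal /=; case: odd => /=; lia.
by rewrite nkE -(addn0 (2 ^ _)%N); case: odd e => /=; lia.
Qed.

Lemma nkS (k : nat) : nk k.+1 = (nk k + jacobsthal k)%N.
Proof. by rewrite !nk_jacobsthal /jacobsthal /=; case: odd => /=; lia. Qed.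

(** Of jacobsthal_half k and its successor, the odd one is the Jacobsthal number
of index k - 1; at k = 0 it is 1, which the truncated predecessor returns
too. *)
Lemma diff2_det_jacobsthal_half (k : nat) :
  diff2_det (jacobsthal_half k.+1) =
    diff_det (jacobsthal k.-1) *
    ('X^(jacobsthal_half k) * diff2_det (jacobsthal_half k)).
Proof.
have -> : jacobsthal k.-1 = (jacobsthal_half k + ~~ odd k)%N.
  by case: k => [|k] //; rewrite /jacobsthal /=; case: odd => /=; lia.
rewrite -diff2_det_split; last by case: odd => /=; lia.
by congr diff2_det => /=; lia.
Qed.

(** The second-difference determinant is eliminated between two consecutive
indices: its square is, up to explicit factors, [diff_det] at a Jacobsthal
number. *)
Lemma diff_det_jacobsthal_rec (k : nat) :
  'X^(2 * jacobsthal_half k) * diff_det (jacobsthal k.+1) =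
    - 'X^(4 * jacobsthal_half k.+1) * diff_det (jacobsthal k) *
      diff_det (jacobsthal k.-1) ^+ 2.
Proof.
rewrite (diff_det_odd (jacobsthal_half k.+1)).
rewrite (diff_det_odd (jacobsthal_half k)).
rewrite diff2_det_jacobsthal_half.
have -> : (-1) ^+ jacobsthal_half k.+1 =
    - (-1) ^+ jacobsthal_half k :> {poly int}.
  rewrite -signr_odd -[in RHS]signr_odd.
  by rewrite !odd_jacobsthal_half /=; case: odd; rewrite ?opprK.
by rewrite ![(_ * jacobsthal_half k)%N]mulnC !exprM; ring.
Qed.

Lemma diff_det_jacobsthal (k : nat) :
  diff_det (jacobsthal k) = (-1) ^+ k * 'X^(k * jacobsthal k + odd k) *
    ('X - 2%:P) ^+ jacobsthal k.
Proof.
have base : diff_det (jacobsthal 0) = 'X - 2%:P.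
  by rewrite diff_det_odd muln0 !expr0 !mul1r /diff2_det det_mx00 expr1n mulr1.
(* The recurrence has order two, so the claim is proved for k and k - 1
   together. *)
suff [] : diff_det (jacobsthal k) = (-1) ^+ k * 'X^(k * jacobsthal k + odd k) *
    ('X - 2%:P) ^+ jacobsthal k /\ diff_det (jacobsthal k.-1) =
    (-1) ^+ k.-1 * 'X^(k.-1 * jacobsthal k.-1 + odd k.-1) *
    ('X - 2%:P) ^+ jacobsthal k.-1 by [].
elim: k => [|k [IH1 IH2]]; first by rewrite base !expr0 mul1r expr1 mul1r.
split; last exact: IH1.
have Xh_neq0 : 'X^(2 * jacobsthal_half k) != 0 :> {poly int}.
  by rewrite expf_neq0 ?X_neq0.
apply: (mulfI Xh_neq0); rewrite diff_det_jacobsthal_rec IH1 IH2.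
rewrite !exprMn -!exprM [(k.-1 * 2)%N]mulnC [(-1) ^+ (2 * _)]exprM sqrrN expr1n.
rewrite expr1n mul1r.
have eX : (2 * jacobsthal_half k + (k.+1 * jacobsthal k.+1 + odd k.+1) =
  4 * jacobsthal_half k.+1 + (k * jacobsthal k + odd k) +
  (k.-1 * jacobsthal k.-1 + odd k.-1) * 2)%N.
  case: k {IH1 IH2 Xh_neq0} => [|k] //; rewrite /jacobsthal /=.
  by case: odd => /=; lia.
have eY : (jacobsthal k.+1 = jacobsthal k + jacobsthal k.-1 * 2)%N.
  case: k {IH1 IH2 Xh_neq0 eX} => [|k] //; rewrite /jacobsthal /=.
  by case: odd => /=; lia.
rewrite [RHS](_ : _ = (-1) ^+ k.+1 * 'X^(4 * jacobsthal_half k.+1 +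
  (k * jacobsthal k + odd k) + (k.-1 * jacobsthal k.-1 + odd k.-1) * 2) *
  ('X - 2%:P) ^+ (jacobsthal k + jacobsthal k.-1 * 2)).
  by rewrite exprS !exprD; ring.
by rewrite -eX -eY [in RHS]exprD; ring.
Qed.

(** * Hankel determinants of the digit polynomials *)

Definition geom (k : nat) : {poly int} := \sum_(i < k) 'X^i.

Lemma geomS k : geom k.+1 = 'X * geom k + 1.
Proof.
rewrite /geom big_ord_recl addrC expr0; congr (_ + _).
by rewrite big_distrr; apply: eq_bigr => i _; rewrite exprS.
Qed.

Lemma ones_coef_digit_split (p q : nat) : (q <= p <= q.+1)%N -> (0 < p)%N ->
  ones_coef (digit_hankel (p + q)) =
    'X^(p.-1) * ones_coef (digit_hankel p) * diff_det q.
Proof.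
move=> pq p0.
have /eqP := det_digit_hankel_split p q 1 pq.
have /eqP := det_digit_hankel_split p q 0 pq.
rewrite !det_add_const !(mul0r, mul1r, addr0) => /eqP -> /eqP.
move=> e; apply: (mulfI X_neq0); rewrite !mulrA -exprS prednK //.
rewrite -scale_ones_coef -mulrA; congr (_ * _).
by apply: (addrI (\det ('X *: digit_hankel p) * diff_det q -
  ones_coef ('X *: digit_hankel p) * ones_coef ('X *: diff_hankel q)));
  rewrite e; ring.
Qed.

(** The quotient c = -(X - 2) det / ones_coef is mapped to X c + 1 by the
parity splitting, independently of the sizes, because the determinant of the
block of odd indices is X - 2 times its linear coefficient. *)
Lemma digit_hankel_ratio_split (p r : nat) (c : {poly int}) :
  (1 + r + r <= p <= (1 + r + r).+1)%N ->
  ('X - 2%:P) * \det (digit_hankel p) = - c * ones_coef (digit_hankel p) ->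
  ('X - 2%:P) * \det (digit_hankel (p + (1 + r + r))) =
    - ('X * c + 1) * ones_coef (digit_hankel (p + (1 + r + r))).
Proof.
move=> pq ratio_p.
have p_gt0 : (0 < p)%N by lia.
have := det_digit_hankel_split _ _ 0 pq.
rewrite !det_add_const !mul0r !addr0 => ->.
rewrite ones_coef_digit_split // mulrBr.
rewrite [X in _ - X]mulrCA -diff_det_ones_coef_odd.
have -> : ones_coef ('X *: digit_hankel p) =
    'X^(p.-1) * ones_coef (digit_hankel p).
  by apply: (mulfI X_neq0); rewrite scale_ones_coef mulrA -exprS prednK.
rewrite detZ -[X in 'X^X * \det _](prednK p_gt0) exprS.
have -> : ('X - 2%:P) * ('X * 'X^(p.-1) * \det (digit_hankel p) *
    diff_det (1 + r + r)) = 'X * 'X^(p.-1) * diff_det (1 + r + r) *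
    (('X - 2%:P) * \det (digit_hankel p)) by ring.
by rewrite ratio_p; ring.
Qed.

Lemma digit_hankel1 : digit_hankel 1 = 0.
Proof.
apply/matrixP => i j; rewrite !mxE !ord1 (digit_poly_widen _ 0) //.
by rewrite big_ord0.
Qed.

Lemma ones_coef_digit_hankel1 : ones_coef (digit_hankel 1) = 1.
Proof.
have := det_add_const _ _ (digit_hankel 1) 1.
by rewrite digit_hankel1 add0r !det_mx11 !mxE add0r mul1r.
Qed.

(** Since n_0 = 1 + 1, the induction can start from the zero matrix of size 1,
whose quotient is the empty geometric sum. *)
Lemma hankel_nk_ratio (k : nat) :
  ('X - 2%:P) * \det (digit_hankel (nk k)) =
    - geom k.+1 * ones_coef (digit_hankel (nk k)).
Proof.
elim: k => [|k IH].
  have -> : nk 0 = (1 + (1 + 0 + 0))%N by rewrite nkE.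
  rewrite geomS; apply: digit_hankel_ratio_split => //.
  by rewrite digit_hankel1 det_mx11 mxE mulr0 /geom big_ord0 oppr0 mul0r.
rewrite geomS nkS; apply: digit_hankel_ratio_split IH.
by rewrite nk_jacobsthal /jacobsthal; case: odd; lia.
Qed.

Lemma absz_alphaS (k : nat) :
  `|alpha k.+1|%N = (`|alpha k| + (nk k).-1 + k * jacobsthal k + odd k)%N.
Proof.
have := alpha_ge0 k; have := alpha_ge0 k.+1; rewrite /alpha nkS.
have -> : ((k.+1 + 1) %/ 2 = (k + 1) %/ 2 + ~~ odd k)%N by lia.
have := nk_ge2 k; case: odd => /=; nia.
Qed.

Lemma ones_coef_digit_hankel_nk (k : nat) :
  ones_coef (digit_hankel (nk k)) =
    - (-1) ^+ ((k + 1) * (k + 2) %/ 2)%N * 'X^(`|alpha k|%N)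
      * ('X - 2%:P) ^+ (nk k).-1.
Proof.
elim: k => [|k IH].
  have -> : `|alpha 0|%N = 0%N by rewrite /alpha nkE.
  have -> : nk 0 = (1 + jacobsthal 0)%N by rewrite nkE.
  rewrite ones_coef_digit_split // ones_coef_digit_hankel1.
  rewrite diff_det_jacobsthal /=; ring.
rewrite nkS ones_coef_digit_split; first last.
- by have := nk_ge2 k; lia.
- by rewrite nk_jacobsthal /jacobsthal; case: odd; lia.
rewrite IH diff_det_jacobsthal absz_alphaS.
have -> : ((k.+1 + 1) * (k.+1 + 2) %/ 2 = (k + 1) * (k + 2) %/ 2 + k.+2)%N.
  have -> : ((k.+1 + 1) * (k.+1 + 2) = (k + 1) * (k + 2) + k.+2 * 2)%N by lia.
  by rewrite addnC divnMDl // addnC.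
have -> : ((nk k + jacobsthal k).-1 = (nk k).-1 + jacobsthal k)%N.
  by have := nk_ge2 k; lia.
rewrite !exprD [_ ^+ k.+2]exprS [_ ^+ k.+1]exprS.
by move: (_ %/ _)%N (nk k).-1 `|alpha k|%N => s n a; ring.
Qed.

Theorem theorem4p4 (k : nat) :
  hankel (nk k) =
    (-1) ^+ ((k + 1) * (k + 2) %/ 2)%N * 'X^(`|alpha k|%N)
      * ('X - 2%:P) ^+ (nk k - 2)%N * \sum_(i < k.+1) 'X^i
  /\ (hankel (nk k)).[1] = (-1) ^+ ((k + 2) * (k + 3) %/ 2)%N * (k + 1)%N%:Z.
Proof.
have hankelE : hankel (nk k) =
    (-1) ^+ ((k + 1) * (k + 2) %/ 2)%N * 'X^(`|alpha k|%N)
      * ('X - 2%:P) ^+ (nk k - 2)%N * \sum_(i < k.+1) 'X^i.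
  have X2_neq0 : 'X - 2%:P != 0 :> {poly int} by rewrite polyXsubC_eq0.
  apply: (mulfI X2_neq0).
  have := hankel_nk_ratio k; rewrite ones_coef_digit_hankel_nk => ->.
  have -> : (nk k).-1 = (nk k - 2).+1 by have := nk_ge2 k; lia.
  by rewrite exprS /geom; move: (_ %/ _)%N (nk k - 2)%N `|_|%N => s n a; ring.
split=> //; rewrite hankelE.
rewrite hornerM; have -> : (\sum_(i < k.+1) 'X^i).[1] = (k + 1)%N%:Z.
  rewrite horner_sum (eq_bigr (fun=> 1)); last first.
    by move=> i _; rewrite hornerXn expr1n.
  by rewrite sumr_const card_ord addn1 natz.
congr (_ * _).
rewrite !hornerE expr1n mulr1 (_ : 1 - 2 = -1 :> int) //.
have -> : ((k + 2) * (k + 3) %/ 2 = (k + 1) * (k + 2) %/ 2 + k.+2)%N.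
  have -> : ((k + 2) * (k + 3) = (k + 1) * (k + 2) + k.+2 * 2)%N by lia.
  by rewrite addnC divnMDl // addnC.
have odd_nk : odd (nk k - 2) = odd k.+2.
  rewrite oddB ?nk_ge2 // nk_jacobsthal /jacobsthal !oddD oddb /=.
  by case: (odd (jacobsthal_half k)); case: (odd k).
by rewrite exprD -[X in _ * X = _]signr_odd odd_nk signr_odd.
Qed.
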